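(* Let $p\ge 2$ be an integer. If $G$ is a minimal cograph obstruction for arboricity $p$ with cotree $T$, then the height of $T$ is at most $4p+1$.
   Context: All graphs are finite and simple. A cograph is a graph with no induced path $P_4$ on four vertices; equivalently, a graph obtainable from $K_1$ by repeatedly applying disjoint union and complement. A minimal cograph obstruction for arboricity $p$ is a cograph whose vertex set cannot be partitioned into $p$ (possibly empty) subsets each inducing a forest, but such that the vertex set of every proper induced subgraph can be so partitioned. The cotree of a cograph $G$ is the unique rooted tree whose leaves are the vertices of $G$, whose internal nodes each have at least two children and are labelled ''union'' or ''join'', such that every child of a join node is a union node or a leaf and every child of a union node is a join node or a leaf, and such that two vertices of $G$ are adjacent if and only if their lowest common ancestor is a join node. The height of a cotree is the number of nodes (levels) on a longest root-to-leaf path; e.g. the cotree of $K_n$, $n\ge 2$, has height two. *)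

(* Defs.v *)
From HB Require Import structures.
From mathcomp Require Import all_boot.

Set Implicit Arguments.
Unset Strict Implicit.
Unset Printing Implicit Defensive.

Record sgraph := SGraph {
  vertex :> finType;
  adj : rel vertex;
  adj_sym : symmetric adj;
  adj_irrefl : irreflexive adj }.

Definition induced_P4 (G : sgraph) (f : 'I_4 -> G) : Prop :=
  injective f /\
  forall i j : 'I_4, adj (f i) (f j) = (i.+1 == j) || (j.+1 == i).

Definition cograph (G : sgraph) : Prop := ~ exists f : 'I_4 -> G, induced_P4 f.

(* [ucycle] also accepts the empty sequence and the back-and-forth walk
   [:: x; y] along an edge; the genuine cycles are those of size at least 3. *)
Definition induces_forest (G : sgraph) (S : {set G}) : Prop :=
  forall s : seq G, {subset s <= S} -> 2 < size s -> ~ ucycle (@adj G) s.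

Definition forest_partitionable (G : sgraph) (p : nat) (S : {set G}) : Prop :=
  exists P : 'I_p -> {set G},
    [/\ forall i j, i != j -> [disjoint P i & P j],
        \bigcup_i P i = S
      & forall i, induces_forest (P i)].

(* Induced subgraphs are represented by their vertex sets. *)
Definition minimal_cograph_obstruction (p : nat) (G : sgraph) : Prop :=
  [/\ cograph G,
      ~ forest_partitionable p [set: G]
    & forall S : {set G}, S \proper [set: G] -> forest_partitionable p S].

(* Rooted trees with labelled internal nodes: in [CNode b cs] the label [b] is
   [true] for "join" and [false] for "union". The order of the children [cs]
   is irrelevant to everything below. *)
Inductive ctree (V : Type) : Type :=
| CLeaf of V
| CNode of bool & seq (ctree V).

Fixpoint leaves (V : Type) (t : ctree V) : seq V :=
  match t with
  | CLeaf x => [:: x]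
  | CNode _ cs => flatten (map (@leaves V) cs)
  end.

(* Counts levels, so that a single leaf has height 1. *)
Fixpoint height (V : Type) (t : ctree V) : nat :=
  match t with
  | CLeaf _ => 1
  | CNode _ cs => (foldr maxn 0 (map (@height V) cs)).+1
  end.

(* The nodes of a tree, each given as the subtree rooted at it. *)
Fixpoint subtrees (V : Type) (t : ctree V) : seq (ctree V) :=
  t :: match t with
       | CLeaf _ => [::]
       | CNode _ cs => flatten (map (@subtrees V) cs)
       end.

Definition alternates (V : Type) (b : bool) (c : ctree V) : bool :=
  if c is CNode b' _ then b' != b else true.

Definition well_labelled (V : Type) (t : ctree V) : bool :=
  all (fun s => if s is CNode b cs then (1 < size cs) && all (alternates b) cs
                else true) (subtrees t).

Definition common_ancestor (V : eqType) (x y : V) (s : ctree V) : bool :=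
  (x \in leaves s) && (y \in leaves s).

(* The lowest common ancestor of the leaves [x] and [y] is the common ancestor
   none of whose children is a common ancestor. *)
Definition lca_is_join (V : eqType) (t : ctree V) (x y : V) : bool :=
  has (fun s => if s is CNode true cs
                then common_ancestor x y s && ~~ has (common_ancestor x y) cs
                else false) (subtrees t).

Definition is_cotree (G : sgraph) (t : ctree G) : Prop :=
  [/\ well_labelled t,
      uniq (leaves t),
      forall x : G, x \in leaves t
    & forall x y : G, x != y -> adj x y = lca_is_join t x y].

(* Main.v *)
(* Every join node on a root-to-leaf path contributes, through a child off the
   path, a new vertex of a clique, and labels alternate along the path; so a
   cotree of height h yields a clique with at least h / 2 vertices, and with at
   least (h + 1) / 2 vertices when the root is not a union node.  A forest
   contains at most two vertices of a clique, so by minimality every clique has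
   at most 2p + 1 vertices, and at most 2p when it misses a vertex, which is the
   case below a union root. *)

Require Import Defs.
From mathcomp Require Import all_boot.
From mathcomp Require Import zify.

Set Implicit Arguments.
Unset Strict Implicit.
Unset Printing Implicit Defensive.

(** Three distinct vertices of a clique form a triangle, which is a cycle of size 3. *)
Lemma clique_forest_card (G : sgraph) (A : {set G}) :
  {in A &, forall x y, x != y -> adj x y} -> induces_forest A -> #|A| <= 2.
Proof.
move=> clA forA; rewrite leqNgt; apply/negP => /card_gt2P.
move=> [x [y [z [[xA yA zA] [xy yz zx]]]]].
apply: (forA [:: x; y; z]) => //.
  by move=> u; rewrite !inE => /or3P[] /eqP->.
apply/andP; split=> /=; first by rewrite !clA.
by rewrite !inE negb_or xy yz eq_sym zx.
Qed.

Lemma clique_partitionable_card (G : sgraph) (p : nat) (S : {set G}) :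
  {in S &, forall x y, x != y -> adj x y} ->
  forest_partitionable p S -> #|S| <= p.*2.
Proof.
move=> clS [P [_ defS forP]].
have Pi2 i : #|P i| <= 2.
  apply: (clique_forest_card (A := P i)) => // x y xP yP.
  by apply: clS; rewrite -defS; apply/bigcupP; exists i.
(* Writing [p * 2] as a sum of 2 over ['I_p] lets the union of the parts and the sum be compared
   term by term. *)
rewrite -defS -muln2 -[X in X * 2]card_ord -sum_nat_const.
elim/big_ind2: _ => [|A m B n Am Bn|i _]; rewrite ?cards0 //.
by apply: leq_trans (leq_card_setU _ _) _; apply: leq_add.
Qed.

Section Cotree.

Variable V : eqType.
Implicit Types (t c : ctree V) (cs : seq (ctree V)).

(** Gives the next node of a longest path, with its siblings [cs1] and [cs2] kept apart as a source
    of leaves off the path. *)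
Lemma tallest_child cs :
  0 < size cs -> exists c cs1 cs2,
    cs = cs1 ++ c :: cs2 /\ height c = foldr maxn 0 (map (@height V) cs).
Proof.
elim: cs => // c [|c' cs] IH _.
  by exists c, [::], [::]; rewrite /= maxn0.
have [//|d [cs1 [cs2 [-> /= <-]]]] := IH.
have [le|lt] := leqP (height c) (height d).
  by exists d, (c :: cs1), cs2.
by exists c, [::], (cs1 ++ d :: cs2).
Qed.

Lemma height_child cs1 c cs2 b :
  height c < height (CNode b (cs1 ++ c :: cs2)).
Proof.
by rewrite /= ltnS; elim: cs1 => [|d cs1 IH] /=; rewrite leq_max ?leqnn ?IH ?orbT.
Qed.

Lemma well_labelled_child b cs1 c cs2 :
  well_labelled (CNode b (cs1 ++ c :: cs2)) -> well_labelled c.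
Proof.
rewrite /well_labelled [subtrees _]/= [all _ (_ :: _)]/= => /andP[_].
rewrite map_cat flatten_cat all_cat => /andP[_].
by rewrite [flatten _]/= all_cat => /andP[].
Qed.

Lemma leaves_child b cs1 c cs2 :
  leaves (CNode b (cs1 ++ c :: cs2)) =
  leaves (CNode b cs1) ++ leaves c ++ leaves (CNode b cs2).
Proof. by rewrite /= map_cat flatten_cat. Qed.

Lemma lca_is_join_child b cs1 c cs2 x y :
  lca_is_join c x y -> lca_is_join (CNode b (cs1 ++ c :: cs2)) x y.
Proof.
rewrite /lca_is_join => xy; rewrite [subtrees _]/= [has _ (_ :: _)]/=.
apply/orP; right.
by rewrite map_cat flatten_cat has_cat [flatten (map _ (c :: _))]/= has_cat xy !orbT.
Qed.

Lemma leaves_gt0 t : well_labelled t -> 0 < size (leaves t).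
Proof.
have [n] := ubnP (height t); elim: n t => // n IH [x|b [|c cs]] //= ht wt.
have /= htc := height_child [::] c cs b.
have := IH c (leq_trans htc ht) (well_labelled_child (cs1 := [::]) wt).
by rewrite size_cat; case: (size _).
Qed.

(** An internal node has a second child, and every well-labelled subtree has a leaf. At a join node
    this leaf enlarges the clique; at a union node it is a vertex that the clique misses. *)
Lemma leaf_off_child b cs1 c cs2 :
  well_labelled (CNode b (cs1 ++ c :: cs2)) ->
  exists x, x \in leaves (CNode b cs1) ++ leaves (CNode b cs2).
Proof.
move=> wt; have /andP[/andP[sz _] _] := wt.
suff: 0 < size (leaves (CNode b cs1) ++ leaves (CNode b cs2)).
  by case: (_ ++ _) => // x l _; exists x; apply: mem_head.
case: cs1 wt sz => [|d cs1] wt sz.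
  case: cs2 wt sz => [//|d cs2] wt _.
  have := leaves_gt0 (well_labelled_child (cs1 := [:: c]) wt).
  by rewrite /= size_cat; case: (size _).
have := leaves_gt0 (well_labelled_child (cs1 := [::]) wt).
by rewrite /= !size_cat; case: (size _).
Qed.

Lemma common_ancestorC x y t : common_ancestor x y t = common_ancestor y x t.
Proof. exact: andbC. Qed.

Lemma lca_is_joinC t x y : lca_is_join t x y = lca_is_join t y x.
Proof.
apply: eq_has => -[//|[] // cs].
by rewrite common_ancestorC (eq_has (common_ancestorC x y)).
Qed.

Lemma has_common_ancestor b cs x y :
  has (common_ancestor x y) cs -> x \in leaves (CNode b cs).
Proof.
elim: cs => //= c cs IH /orP[/andP[xc _]|/IH]; rewrite mem_cat ?xc //.
by move=> ->; rewrite orbT.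
Qed.

(** Since leaves are not repeated, [x] occurs only below [c] and [y] only below the other children,
    so no child is a common ancestor. *)
Lemma lca_is_join_root cs1 c cs2 x y :
  uniq (leaves (CNode true (cs1 ++ c :: cs2))) -> x \in leaves c ->
  y \in leaves (CNode true cs1) ++ leaves (CNode true cs2) ->
  lca_is_join (CNode true (cs1 ++ c :: cs2)) x y.
Proof.
rewrite /lca_is_join [subtrees _]/= [has _ (_ :: _)]/= /common_ancestor.
rewrite leaves_child => ut xc yr.
have:= ut; rewrite uniq_catCA cat_uniq => /and3P[_ /hasPn dis _].
have yc : y \notin leaves c by apply: dis.
have: x \notin leaves (CNode true cs1) ++ leaves (CNode true cs2).
  by apply/negP => /dis; rewrite /= xc.
rewrite mem_cat negb_or => /andP[x1 x2].
apply/orP; left; rewrite !mem_cat xc orbT /=.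
move: yr; rewrite mem_cat orbCA => ->; rewrite orbT /=.
rewrite has_cat /= (negbTE yc) andbF /= negb_or.
by rewrite (contra (@has_common_ancestor true _ _ _) x1)
           (contra (@has_common_ancestor true _ _ _) x2).
Qed.

Definition is_union t := if t is CNode false _ then true else false.

(** The extra unit for a root that is a leaf or a join is saved up in the induction to pay for a
    union node placed above it. *)
Lemma clique_of_height t :
  well_labelled t -> uniq (leaves t) ->
  exists s : seq V,
    [/\ uniq s, {subset s <= leaves t},
        {in s &, forall x y, x != y -> lca_is_join t x y},
        height t + ~~ is_union t <= (size s).*2
      & is_union t -> exists2 x, x \in leaves t & x \notin s].
Proof.
have [n] := ubnP (height t); elim: n t => // n IH [x|b cs] ht wt ut.
  exists [:: x]; split=> // y z; rewrite !inE => /eqP-> /eqP->.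
  by rewrite eqxx.
have /andP[/andP[sz alt] _] := wt.
have [c [cs1 [cs2 [def_cs hc]]]] := tallest_child (ltnW sz).
have {}hc : height (CNode b cs) = (height c).+1 by rewrite /= -hc.
rewrite {cs sz}def_cs in ht wt ut alt hc *.
have {alt} altc : alternates b c by move: alt; rewrite all_cat /= => /and3P[].
have [y yr] := leaf_off_child wt.
have := ut; rewrite [X in uniq X]leaves_child uniq_catCA cat_uniq => /and3P[uc /hasPn dis _].
have yc : y \notin leaves c by apply: dis.
have [s [us sc cls hs _]] :=
  IH c (leq_trans (height_child cs1 c cs2 b) ht) (well_labelled_child wt) uc.
have sub x : x \in s -> x \in leaves (CNode b (cs1 ++ c :: cs2)).
  by move=> /sc xc; rewrite leaves_child !mem_cat xc orbT.
have yt : y \in leaves (CNode b (cs1 ++ c :: cs2)).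
  by move: yr; rewrite leaves_child !mem_cat orbCA => ->; rewrite orbT.
have ys : y \notin s by apply: contra yc; apply: sc.
have clt : {in s &, forall x z, x != z ->
    lca_is_join (CNode b (cs1 ++ c :: cs2)) x z}.
  by move=> x z xs zs xz; apply: lca_is_join_child; apply: cls.
rewrite hc; case: b {wt hc ht dis} altc => altc in ut yr sub yt clt *.
  (* Join root: the new vertex [y] adds 2 to the doubled size, one for the new level and one for the
     extra unit. *)
  exists (y :: s); split=> //.
  - by rewrite /= ys.
  - by move=> x; rewrite inE => /predU1P[->|/sub].
  - move=> x z; rewrite !inE => /predU1P[->|xs] /predU1P[->|zs] //.
    + by rewrite eqxx.
    + by move=> _; rewrite lca_is_joinC lca_is_join_root ?sc.
    + by move=> _; rewrite lca_is_join_root ?sc.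
    + exact: clt.
  - by rewrite doubleS addn1 !ltnS; apply: leq_trans hs; apply: leq_addr.
(* Union root: the clique is unchanged. By alternation [c] is a leaf or a join, so its extra unit
   pays for the new level. *)
exists s; split=> //; last by exists y.
by case: c altc hs {cls sc yc uc sub clt ut yt} => [?|[]] //= *; rewrite addn0 -addn1.
Qed.

End Cotree.

Theorem theorem7 (p : nat) (hp : 2 <= p) (G : sgraph) (T : ctree G)
    (hG : minimal_cograph_obstruction p G) (hT : is_cotree T) :
  height T <= 4 * p + 1.
Proof.
have [_ _ minG] := hG; have [wT uT _ adjT] := hT.
have [s [us _ cls hs missing]] := clique_of_height wT uT.
have proper_clique (r : seq G) x :
    uniq r -> {subset r <= s} -> x \notin r -> size r <= p.*2.
  move=> ur rs xr.
  have <- : #|[set y in r]| = size r by rewrite cardsE; apply/card_uniqP.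
  apply: clique_partitionable_card.
    by move=> y z; rewrite !inE => /rs ys /rs zs yz; rewrite adjT // cls.
  by apply: minG; apply/properP; split; last by exists x; rewrite ?inE.
have le_s : size s <= p.*2.+1.
  (* Dropping one vertex of the clique leaves a clique that misses it. *)
  case: s us proper_clique {cls hs missing} => //= x r /andP[xr ur] pc.
  by rewrite ltnS (pc r x) // => y yr; rewrite inE yr orbT.
case: (boolP (is_union T)) hs missing => _ hs missing; last first.
  (* Leaf or join root: [height T + 1] is at most [2 * (2 * p + 1)]. *)
  by rewrite -(leq_add2r 1); apply: leq_trans hs _; move: le_s; rewrite -leq_double; lia.
(* Union root: the whole clique misses [x], so the height is at most [2 * (2 * p)]. *)
have [//|x _ xs] := missing; have := proper_clique s x us (fun=> id) xs.
rewrite addn0 in hs; rewrite -leq_double => le_s2.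
by apply: leq_trans hs (leq_trans le_s2 _); lia.
Qed.
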